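(* Let $a_1,a_2$ and $b_1,b_2$ be nonreal quaternions with $\operatorname{Im} a_1\neq \operatorname{Im} a_2$. Then the equation $$W_2(q)=\sum_{\ell=1}^{2}\bigl|q^{-1}a_\ell q-b_\ell\bigr|^2=0$$ has a solution (a nonzero quaternion $q$) if and only if $(a_1,a_2)\sim(b_1,b_2)$.
   Context: Quaternions are real (Hamilton) quaternions. For $a=a_w+a_x i+a_y j+a_z k$, $\operatorname{Re} a=a_w$ is the real part, $\operatorname{Im} a=a_x i+a_y j+a_z k$ is the imaginary (vector) part, and $|a|=\sqrt{a_w^2+a_x^2+a_y^2+a_z^2}$. A quaternion is nonreal if $\operatorname{Im} a\neq 0$. Pairwise similarity: sets of nonreal quaternions $\{a_1,\dots,a_n\}$, $\{b_1,\dots,b_n\}$ with $n\ge 2$ and $\operatorname{Im} a_\ell\neq\operatorname{Im} a_m$ for all $\ell\neq m$ are called pairwise similar, written $(a_1,\dots,a_n)\sim(b_1,\dots,b_n)$, if there exists a nonzero quaternion $p$ such that $p^{-1}a_\ell p=b_\ell$ for all $\ell\in\{1,\dots,n\}$. *)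

(* Defs.v *)
From HB Require Import structures.
From mathcomp Require Import all_boot all_order all_algebra.
From mathcomp Require Import ring lra.
From mathcomp Require Import reals.

Set Implicit Arguments.
Unset Strict Implicit.
Unset Printing Implicit Defensive.

Import Order.TTheory GRing.Theory Num.Theory.
Local Open Scope ring_scope.

(* [Quat w x y z] is the quaternion w + x i + y j + z k. *)
Record quaternion (R : Type) : Type := Quat { qw : R; qx : R; qy : R; qz : R }.

Section QuaternionChoice.

Variable R : Type.

Definition quat_to_prod (a : quaternion R) := (qw a, qx a, qy a, qz a).
Definition prod_to_quat (t : R * R * R * R) :=
  let: (w, x, y, z) := t in Quat w x y z.

Lemma quat_to_prodK : cancel quat_to_prod prod_to_quat.
Proof. by case. Qed.

End QuaternionChoice.

HB.instance Definition _ (R : eqType) :=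
  Equality.copy (quaternion R) (can_type (@quat_to_prodK R)).
HB.instance Definition _ (R : choiceType) :=
  Choice.copy (quaternion R) (can_type (@quat_to_prodK R)).

Section QuaternionRing.

Variable R : realFieldType.
Implicit Types a b c : quaternion R.

Definition quat_zero : quaternion R := Quat 0 0 0 0.
Definition quat_one : quaternion R := Quat 1 0 0 0.
Definition quat_opp a := Quat (- qw a) (- qx a) (- qy a) (- qz a).
Definition quat_add a b :=
  Quat (qw a + qw b) (qx a + qx b) (qy a + qy b) (qz a + qz b).
Definition quat_mul a b := Quat
  (qw a * qw b - qx a * qx b - qy a * qy b - qz a * qz b)
  (qw a * qx b + qx a * qw b + qy a * qz b - qz a * qy b)
  (qw a * qy b - qx a * qz b + qy a * qw b + qz a * qx b)
  (qw a * qz b + qx a * qy b - qy a * qx b + qz a * qw b).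

Lemma quat_addA : associative quat_add.
Proof. by move=> a b c; rewrite /quat_add /= !addrA. Qed.

Lemma quat_addC : commutative quat_add.
Proof. by move=> a b; congr Quat; rewrite addrC. Qed.

Lemma quat_add0 : left_id quat_zero quat_add.
Proof. by case=> *; rewrite /quat_add /= !add0r. Qed.

Lemma quat_addN : left_inverse quat_zero quat_opp quat_add.
Proof. by case=> *; rewrite /quat_add /= !addNr. Qed.

HB.instance Definition _ := GRing.isZmodule.Build (quaternion R)
  quat_addA quat_addC quat_add0 quat_addN.

Lemma quat_mulA : associative quat_mul.
Proof. by move=> a b c; congr Quat => /=; ring. Qed.

Lemma quat_mul1l : left_id quat_one quat_mul.
Proof. by case=> w x y z; congr Quat => /=; ring. Qed.

Lemma quat_mul1r : right_id quat_one quat_mul.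
Proof. by case=> w x y z; congr Quat => /=; ring. Qed.

Lemma quat_mulDl : left_distributive quat_mul +%R.
Proof. by move=> a b c; congr Quat => /=; ring. Qed.

Lemma quat_mulDr : right_distributive quat_mul +%R.
Proof. by move=> a b c; congr Quat => /=; ring. Qed.

Lemma quat_one_neq0 : quat_one != 0.
Proof. by apply/eqP => -[] /eqP; rewrite oner_eq0. Qed.

HB.instance Definition _ := GRing.Zmodule_isNzRing.Build (quaternion R)
  quat_mulA quat_mul1l quat_mul1r quat_mulDl quat_mulDr quat_one_neq0.

Definition quat_sqnorm a := qw a ^+ 2 + qx a ^+ 2 + qy a ^+ 2 + qz a ^+ 2.

Lemma quat_sqnorm_eq0 a : (quat_sqnorm a == 0) = (a == 0).
Proof.
apply/eqP/eqP => [|->]; last by rewrite /quat_sqnorm expr0n /= !addr0.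
case: a => w x y z; rewrite /quat_sqnorm /= => e.
have [w2 x2 y2 z2] := And4 (sqr_ge0 w) (sqr_ge0 x) (sqr_ge0 y) (sqr_ge0 z).
by congr Quat; apply/eqP; rewrite -sqrf_eq0; apply/eqP; lra.
Qed.

(* The value at 0 is 0, as required by [unitRingType]. *)
Definition quat_inv a := let n := quat_sqnorm a in
  Quat (qw a / n) (- qx a / n) (- qy a / n) (- qz a / n).

Definition quat_unit : pred (quaternion R) := [pred a | a != 0].

Lemma quat_mulV : {in quat_unit, left_inverse 1 quat_inv *%R}.
Proof.
move=> a; rewrite inE -quat_sqnorm_eq0 /quat_sqnorm => a0.
by congr Quat; rewrite /= /quat_sqnorm; field.
Qed.

Lemma quat_mulfV : {in quat_unit, right_inverse 1 quat_inv *%R}.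
Proof.
move=> a; rewrite inE -quat_sqnorm_eq0 /quat_sqnorm => a0.
by congr Quat; rewrite /= /quat_sqnorm; field.
Qed.

Lemma quat_unitP a b : b * a = 1 /\ a * b = 1 -> quat_unit a.
Proof.
move=> [ba _]; apply/eqP => a0; move/eqP: ba.
by rewrite a0 mulr0 eq_sym oner_eq0.
Qed.

Lemma quat_inv_out : {in [predC quat_unit], quat_inv =1 id}.
Proof.
move=> a; rewrite !inE negbK => /eqP ->.
by congr Quat; rewrite /= ?oppr0 mul0r.
Qed.

HB.instance Definition _ := GRing.NzRing_hasMulInverse.Build (quaternion R)
  quat_mulV quat_mulfV quat_unitP quat_inv_out.

Definition quat_i : quaternion R := Quat 0 1 0 0.
Definition quat_j : quaternion R := Quat 0 0 1 0.
Definition quat_k : quaternion R := Quat 0 0 0 1.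

Lemma hamilton_relations :
  [/\ quat_i * quat_i = -1, quat_j * quat_j = -1, quat_k * quat_k = -1 &
      quat_i * quat_j * quat_k = -1].
Proof. by split; congr Quat => /=; ring. Qed.

Definition quat_Im a : quaternion R := Quat 0 (qx a) (qy a) (qz a).

Definition nonreal a : Prop := quat_Im a <> 0.

End QuaternionRing.

Definition quat_norm (R : rcfType) (a : quaternion R) : R :=
  Num.sqrt (qw a ^+ 2 + qx a ^+ 2 + qy a ^+ 2 + qz a ^+ 2).

Definition pairwise_similar (R : realType) (n : nat)
    (a b : 'I_n -> quaternion R) : Prop :=
  [/\ (2 <= n)%N,
      forall l, nonreal (a l),
      forall l, nonreal (b l),
      forall l m, l <> m -> quat_Im (a l) <> quat_Im (a m) &
      exists p : quaternion R, p <> 0 /\ forall l, p^-1 * a l * p = b l].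

(* Meaningful only for nonzero [q]: the library sets [0^-1 = 0]. *)
Definition W (R : realType) (n : nat) (a b : 'I_n -> quaternion R)
    (q : quaternion R) : R :=
  \sum_(l < n) quat_norm (q^-1 * a l * q - b l) ^+ 2.

(* Main.v *)
Require Import Defs.
From mathcomp Require Import all_boot all_order all_algebra.
From mathcomp Require Import reals.

Import Order.TTheory GRing.Theory Num.Theory.
Local Open Scope ring_scope.

(** A sum of squares of real numbers vanishes only if every term does, and the quaternion norm is
    definite. Hence [W a b q = 0] says exactly that [q] conjugates each [a l] to [b l] ([W_eq0]), so
    nonzero roots of [W] are the witnesses of similarity. *)

Lemma quat_norm_eq0 (R : rcfType) (a : quaternion R) :
  (quat_norm a == 0) = (a == 0).
Proof.
(* [Num.sqrt] is 0 on all nonpositive reals, so the sign of the radicand matters. *)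
have a_ge0 : 0 <= quat_sqnorm a by rewrite !addr_ge0 ?sqr_ge0.
by rewrite -quat_sqnorm_eq0 /quat_norm sqrtr_eq0 le_eqVlt ltNge a_ge0 orbF.
Qed.

Lemma W_eq0 (R : realType) (n : nat) (a b : 'I_n -> quaternion R)
    (q : quaternion R) :
  W a b q = 0 <-> forall l, q^-1 * a l * q = b l.
Proof.
split=> [/eqP | qab].
  rewrite psumr_eq0 => [/allP W0 l | l _]; last exact: sqr_ge0.
  have := W0 l (mem_index_enum l).
  by rewrite /= sqrf_eq0 quat_norm_eq0 subr_eq0 => /eqP.
apply: big1 => l _; apply/eqP.
by rewrite sqrf_eq0 quat_norm_eq0 subr_eq0 qab.
Qed.

Theorem theorem3p1 (R : realType) (a b : 'I_2 -> quaternion R)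
    (ha : forall l, nonreal (a l)) (hb : forall l, nonreal (b l))
    (hIm : quat_Im (a ord0) <> quat_Im (a ord_max)) :
  (exists q : quaternion R, q <> 0 /\ W a b q = 0) <-> pairwise_similar a b.
Proof.
split=> [[q [q0 /W_eq0 qab]] | [_ _ _ _ [q [q0 qab]]]]; last first.
  by exists q; split=> //; apply/W_eq0.
split=> //; last by exists q.
(* With two indices, the only distinct pairs are that of [hIm] and its mirror image. *)
have ordE (l : 'I_2) : l = ord0 \/ l = ord_max.
  by case: l => [[|[|//]] ltl]; [left | right]; apply: val_inj.
by move=> l m; case: (ordE l) => ->; case: (ordE m) => -> // _ /esym.
Qed.
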